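(* For $f\in\mathcal L_{5,3}^+$ with normalized coefficients $c_\alpha$ ($\alpha\in\Delta_5^3$; e.g. $c_{21000}$ means $c_{(2,1,0,0,0)}$), let $$R_5(f)=\frac{c_{30000}\,c_{21000}\,c_{10101}\,c_{00210}\,c_{00021}}{c_{20100}\,c_{20010}\,c_{20001}\,c_{01110}\,c_{00111}},$$ and let $w_5\in\mathbb R^{\Delta_5^3}$ be its exponent vector (entry $+1$ at the five numerator indices, $-1$ at the five denominator indices, $0$ elsewhere). Then for every $f\in\mathcal L_{5,3}^+$, $R_5(f)\le 32$. Moreover, $$w_5\in\operatorname{BR}(\mathcal L_{5,3}^+)\setminus\operatorname{Cone}\bigl(\mathcal G_5(\Delta_5^3)\bigr).$$ In particular, $\operatorname{Cone}(\mathcal G_5(\Delta_5^3))\subsetneq\operatorname{BR}(\mathcal L_{5,3}^+)$.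
   Context: Notation: $\mathbb N=\mathbb Z_{\ge0}$, $[n]=\{1,\dots,n\}$, $e_i$ is the $i$-th standard basis vector of $\mathbb R^n$; for $\alpha\in\mathbb N^n$, $|\alpha|=\alpha_1+\cdots+\alpha_n$, $\alpha!=\alpha_1!\cdots\alpha_n!$, and $\mathbf x^\alpha=x_1^{\alpha_1}\cdots x_n^{\alpha_n}$; $\Delta_n^d=\{\alpha\in\mathbb N^n:|\alpha|=d\}$. For a finite set $S$, $\varepsilon_\alpha$ ($\alpha\in S$) denotes the standard basis of $\mathbb R^S$. $\operatorname{Cone}(E)$ is the set of finite nonnegative linear combinations of elements of $E$. A nonempty set $S\subseteq\Delta_n^d$ is $M$-convex if, whenever $\alpha,\beta\in S$ and $\alpha_i>\beta_i$, there is $j$ with $\alpha_j<\beta_j$ such that $\alpha-e_i+e_j\in S$ and $\beta-e_j+e_i\in S$. Lorentzian polynomials: for $d\ge2$, a polynomial $f=\sum_{\alpha\in\Delta_n^d}c_\alpha\,\mathbf x^\alpha/\alpha!$ with all $c_\alpha\ge0$, not identically zero, is Lorentzian if and only if its support $\{\alpha:c_\alpha\ne0\}$ is $M$-convex and for every $\beta\in\Delta_n^{d-2}$ the symmetric matrix $H_\beta(f)=(c_{\beta+e_i+e_j})_{1\le i,j\le n}$ (the Hessian of $\partial^\beta f$) has at most one positive eigenvalue. The numbers $c_\alpha$ are called the normalized coefficients of $f$. For an $M$-convex $S\subseteq\Delta_n^d$, $\mathcal L_S^+$ is the set of Lorentzian polynomials whose normalized coefficients $c_\alpha$ are positive exactly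 for $\alpha\in S$; $\mathcal L_{n,d}^+:=\mathcal L_{\Delta_n^d}^+$. For $w\in\mathbb R^S$ and $f\in\mathcal L_S^+$ put $R_w(f)=\prod_{\alpha\in S}c_\alpha^{w_\alpha}$, and $\operatorname{BR}(\mathcal L_S^+)=\{w\in\mathbb R^S:\sup_{f\in\mathcal L_S^+}R_w(f)<\infty\}$. Quadratic local generators: for $\beta\in\Delta_n^{d-2}$ let $S_\beta=\{e_i+e_j:i,j\in[n],\ \beta+e_i+e_j\in S\}\subseteq\Delta_n^2$ (which is $M$-convex whenever nonempty; for $S=\Delta_n^d$ it is $\Delta_n^2$). For $v\in\mathbb R^{S_\beta}$ let $\widetilde v^{\,\beta}=\sum_{\gamma\in S_\beta}v_\gamma\varepsilon_{\beta+\gamma}\in\mathbb R^S$. Then $\mathcal G_n(S)=\bigcup_{\beta\in\Delta_n^{d-2},\,S_\beta\ne\varnothing}\{\widetilde v^{\,\beta}:v\in\operatorname{BR}(\mathcal L_{S_\beta}^+)\}$. *)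

(* Defs.v *)
From HB Require Import structures.
From mathcomp Require Import all_boot all_order all_algebra finmap mpoly.
From mathcomp Require Import classical_sets constructive_ereal reals.
(* Not imported: their notations clash with those of mpoly. *)
From mathcomp Require ereal exp.

Set Implicit Arguments.
Unset Strict Implicit.
Unset Printing Implicit Defensive.

Import Order.TTheory GRing.Theory Num.Theory.
Local Open Scope ring_scope.
Local Open Scope fset_scope.
Local Open Scope classical_set_scope.

Definition Delta (n d : nat) : {fset 'X_{1..n}} :=
  [fset bmnm a | a in {: 'X_{1..n < d.+1}} & mdeg a == d].

(* The subtractions of multi-indices are truncated in general, but not here:
   [b i < a i] and [a j < b j] make them exact. *)
Definition Mconvex (n d : nat) (S : {fset 'X_{1..n}}) : Prop :=
  [/\ S != fset0, S `<=` Delta n d &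
      forall a b : 'X_{1..n}, a \in S -> b \in S ->
      forall i : 'I_n, (b i < a i)%N ->
      exists j : 'I_n, [/\ (a j < b j)%N,
        (a - U_(i) + U_(j))%MM \in S & (b - U_(j) + U_(i))%MM \in S]]%fset.

(* c_a, where f = \sum_a c_a x^a / a! *)
Definition ncoef (R : realType) (n : nat) (f : {mpoly R[n]}) (a : 'X_{1..n})
  : R := f@_a *+ (\prod_(i < n) (a i)`!)%N.

Definition Hess (R : realType) (n : nat) (f : {mpoly R[n]}) (b : 'X_{1..n})
  : 'M[R]_n := \matrix_(i, j) ncoef f (b + U_(i) + U_(j))%MM.

(* [s] lists the eigenvalues with multiplicity; it exists for every symmetric
   real matrix, and this definition is meant for such matrices only. *)
Definition at_most_one_pos_eigenvalue (R : realType) (n : nat) (A : 'M[R]_n)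
  : Prop :=
  exists2 s : seq R, char_poly A = \prod_(x <- s) ('X - x%:P)%R
                   & (count (fun x => (0 < x)%R) s <= 1)%N.

Definition lorentzian (R : realType) (n d : nat) (f : {mpoly R[n]}) : Prop :=
  [/\ f != 0 /\ f \is d.-homog,
      forall a : 'X_{1..n}, 0 <= ncoef f a,
      Mconvex d [fset a in Delta n d | ncoef f a != 0]%fset &
      forall b : 'X_{1..n}, (mdeg b + 2 = d)%N ->
        at_most_one_pos_eigenvalue (Hess f b)].

Definition Lplus (R : realType) (n d : nat) (S : {fset 'X_{1..n}})
  : set {mpoly R[n]} :=
  [set f | lorentzian d f /\ forall a : 'X_{1..n}, (0 < ncoef f a) = (a \in S)].
Arguments Lplus R {n} d S.

Definition Rmon (R : realType) (n : nat) (S : {fset 'X_{1..n}})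
  (w : {ffun S -> R^o}) (f : {mpoly R[n]}) : R :=
  \prod_(a : S) exp.powR (ncoef f (val a)) (w a).

Definition BR (R : realType) (n d : nat) (S : {fset 'X_{1..n}})
  : set {ffun S -> R^o} :=
  [set w | (ereal.ereal_sup [set (Rmon w f)%:E | f in Lplus R d S] < +oo)%E].
Arguments BR R {n} d S.

Definition Sloc (n : nat) (S : {fset 'X_{1..n}}) (b : 'X_{1..n})
  : {fset 'X_{1..n}} :=
  [fset (U_(p.1) + U_(p.2))%MM | p in {: 'I_n * 'I_n}
     & (b + U_(p.1) + U_(p.2))%MM \in S]%fset.

(* [\sum_g v_g eps_(b+g)], written coordinatewise *)
Definition lift_loc (R : realType) (n : nat) (S : {fset 'X_{1..n}})
  (b : 'X_{1..n}) (v : {ffun Sloc S b -> R^o}) : {ffun S -> R^o} :=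
  [ffun a : S => \sum_(g : Sloc S b | val a == (b + val g)%MM) v g].

Definition Gloc (R : realType) (n d : nat) (S : {fset 'X_{1..n}})
  : set {ffun S -> R^o} :=
  [set w | exists (b : 'X_{1..n}) (v : {ffun Sloc S b -> R^o}),
     [/\ (mdeg b + 2 = d)%N, Sloc S b != fset0,
         BR R 2 (Sloc S b) v & w = lift_loc v]].
Arguments Gloc R {n} d S.

Definition Cone (R : realType) (V : lmodType R) (E : set V) : set V :=
  [set x | exists (k : nat) (a : 'I_k -> R) (v : 'I_k -> V),
     [/\ forall i, 0 <= a i, forall i, E (v i) & x = \sum_(i < k) a i *: v i]].

Definition num5 : seq 'X_{1..5} :=
  [:: [multinom of [:: 3; 0; 0; 0; 0]]; [multinom of [:: 2; 1; 0; 0; 0]];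
      [multinom of [:: 1; 0; 1; 0; 1]]; [multinom of [:: 0; 0; 2; 1; 0]];
      [multinom of [:: 0; 0; 0; 2; 1]]]%N.

Definition den5 : seq 'X_{1..5} :=
  [:: [multinom of [:: 2; 0; 1; 0; 0]]; [multinom of [:: 2; 0; 0; 1; 0]];
      [multinom of [:: 2; 0; 0; 0; 1]]; [multinom of [:: 0; 1; 1; 1; 0]];
      [multinom of [:: 0; 0; 1; 1; 1]]]%N.

Definition R5 (R : realType) (f : {mpoly R[5]}) : R :=
  (\prod_(a <- num5) ncoef f a) / (\prod_(a <- den5) ncoef f a).

Definition w5 (R : realType) : {ffun Delta 5 3 -> R^o} :=
  [ffun a : Delta 5 3 => (val a \in num5)%:R - (val a \in den5)%:R].

(* Main.v *)
Require Import Defs.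
From mathcomp Require Import all_boot all_order all_algebra finmap mpoly.
From mathcomp Require Import classical_sets constructive_ereal reals.
From mathcomp Require Import complex ring lra.
From mathcomp Require ereal sequences exp boolp.

(* The normalized coefficients of a cubic f form a symmetric tensor T whose slices
   T_i are Hessians with at most one positive eigenvalue, so the reverse
   Cauchy-Schwarz inequality applies to nonnegative vectors. It gives
   T_ijj T_ikl <= 2 T_ijk T_ijl, and the Ptolemy-type alternative
   T_112 T_134 <= 4 T_113 T_124 or T_112 T_134 <= 4 T_114 T_123. In either
   case three inequalities of the first kind complete it to the bound
   32 = 4 * 2 * 2 * 2. The alternative is what no nonnegative combination of local
   generators can express.

   For the separation, take nu : Delta_5^3 -> R such that every slice nu_i is, up to
   terms x_j + x_k, a nonnegative combination of cut functions [S separates j and k].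
   The matrices exp (t (x_j + x_k + K [S separates j and k])), t >= 0, are Lorentzian
   (rank 2 with one positive eigenvalue), so letting t grow shows that a bounded
   ratio pairs nonpositively with every cut function, hence with nu on every local
   generator; but <w5, nu> = 3. *)

Set Implicit Arguments.
Unset Strict Implicit.
Unset Printing Implicit Defensive.

Import Order.TTheory GRing.Theory Num.Theory.

Local Open Scope ring_scope.
Local Open Scope classical_set_scope.

(** * Symmetric matrices with at most one positive eigenvalue *)

Section QuadraticForms.
Local Open Scope sesquilinear_scope.
Local Open Scope complex_scope.
Context {R : realType} {n : nat}.
Implicit Types (A : 'M[R]_n) (u v x y : 'rV[R]_n).

Definition bform A u v : R := (u *m A *m v^T) 0 0.

Local Notation toC := (map_mx (real_complex R)).

Lemma bformC A u v : A^T = A -> bform A u v = bform A v u.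
Proof.
move=> sA; have -> : bform A u v = ((u *m A *m v^T)^T) 0 0 by rewrite [RHS]mxE.
by rewrite !trmx_mul trmxK sA mulmxA.
Qed.

Lemma bformDl A u v w : bform A (u + v) w = bform A u w + bform A v w.
Proof. by rewrite /bform !mulmxDl mxE. Qed.

Lemma bformZl A a u v : bform A (a *: u) v = a * bform A u v.
Proof. by rewrite /bform -!scalemxAl mxE. Qed.

Lemma bformDr A u v w : bform A w (u + v) = bform A w u + bform A w v.
Proof. by rewrite /bform linearD mulmxDr mxE. Qed.

Lemma bformZr A a u v : bform A u (a *: v) = a * bform A u v.
Proof. by rewrite /bform linearZ -scalemxAr mxE. Qed.

Lemma bform_delta A i j : bform A (delta_mx 0 i) (delta_mx 0 j) = A i j.
Proof. by rewrite /bform -rowE trmx_delta -colE !mxE. Qed.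

Lemma char_poly_conj (F : fieldType) (P D : 'M[F]_n) : P \in unitmx ->
  char_poly (invmx P *m D *m P) = char_poly D.
Proof.
move=> uP; pose pC := @map_mx F _ polyC n n.
have conjE : char_poly_mx (invmx P *m D *m P) =
    pC (invmx P) *m char_poly_mx D *m pC P.
  rewrite /char_poly_mx mulmxBr mulmxBl !map_mxM; congr (_ - _).
  by rewrite mul_mx_scalar -scalemxAl -map_mxM mulVmx // map_mx1 scalemx1.
rewrite /char_poly conjE !det_mulmx mulrAC -det_mulmx -map_mxM.
by rewrite mulVmx // map_mx1 det1 mul1r.
Qed.

(** Diagonalization takes place over [R[i]], where [A] is hermitian with real eigenvalues. The
    hermitian form at [u + i v] is [bform A u u + bform A v v], since symmetry cancels the cross
    terms. *)
Lemma real_spectral A : A^T = A ->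
  exists (d : 'I_n -> R) (P : 'M[R[i]]_n),
    [/\ P \is unitarymx, char_poly A = \prod_i ('X - (d i)%:P)%R &
        forall u v (Z := (toC u + 'i%C *: toC v) *m P^t*),
          (bform A u u + bform A v v)%:C = \sum_i (d i)%:C * `|Z 0 i| ^+ 2].
Proof.
move=> sA.
have hA : toC A \is hermsymmx.
  apply: realsym_hermsym.
    by apply/is_hermitianmxP; rewrite expr0 scale1r map_mx_id // map_trmx sA.
  by apply/mxOverP => i j; rewrite mxE; apply/complex_realP; exists (A i j).
have /hermitian_normalmx/orthomx_spectralP eqA := hA.
have /mxOverP dR := hermitian_spectral_diag_real hA.
set P := spectralmx _ in eqA; set D := spectral_diag _ in eqA dR.
have uP : P \is unitarymx by exact: spectral_unitarymx.
pose d i := complex.Re (D 0 i).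
have dE i : D 0 i = (d i)%:C by rewrite /d RRe_real // dR.
exists d, P; split=> //.
  apply: (map_poly_inj (real_complex R)).
  rewrite map_char_poly rmorph_prod eqA.
  rewrite char_poly_conj ?unitarymx_unit // char_poly_trig ?diag_mx_is_trig //.
  apply: eq_bigr => i _.
  by rewrite rmorphB /= map_polyX map_polyC mxE eqxx mulr1n dE.
move=> u v Z.
pose z := toC u + 'i%C *: toC v.
transitivity ((z *m toC A *m z^t*) 0 0).
  have -> : z^t* = toC u^T - 'i%C *: toC v^T.
    apply/matrixP => i j; rewrite !mxE.
    by apply/eqP; rewrite eq_complex /=; apply/andP; split; apply/eqP; ring.
  rewrite /z !mulmxDl !mulmxBr -!scalemxAl -!scalemxAr -!map_mxM.
  have hB a b : toC (a *m A *m b^T) = ((bform A a b)%:C)%:M.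
    by rewrite [LHS]mx11_scalar mxE.
  rewrite !hB !scale_scalar_mx !mxE !mulr1n (bformC v u sA).
  rewrite rmorphD /= mulrA -expr2 sqr_i; ring.
rewrite eqA invmx_unitary // !mulmxA -/Z -mulmxA.
have -> : P *m z^t* = Z^t*.
  by rewrite /Z trmx_mul map_mxM trmxCK.
rewrite mxE; apply: eq_bigr => i _.
rewrite mul_mx_diag !mxE dE normCK.
ring.
Qed.

(* The coordinate along the positive eigenvector is a complex number even for real
   x and y, so the multiple mu of x that cancels this coordinate of y is complex;
   dropping its imaginary part only decreases the form, as the form is positive
   at x. *)
Lemma at_most_one_pos_eigenvalue_cs A x y : A^T = A ->
  at_most_one_pos_eigenvalue A -> 0 < bform A x x ->
  bform A x x * bform A y y <= bform A x y ^+ 2.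
Proof.
move=> sA [s chs les] qx0; have [d [P [uP chd qE]]] := real_spectral sA.
(* By unique factorization [s] and the values of [d] agree up to order, so at most one [d i] is
   positive. *)
have /prod_XsubC_eq/permP/(_ (fun t => 0 < t)) cnt :
    \prod_(t <- s) ('X - t%:P)%R = \prod_(t <- codom d) ('X - t%:P)%R.
  by rewrite -chs chd big_map big_enum.
have dneg i0 i : 0 < d i0 -> i != i0 -> d i <= 0.
  move=> di0 nei; rewrite leNgt; apply/negP => di.
  move: les; rewrite cnt /codom count_map leqNgt => /negP; apply.
  rewrite -size_filter (@leq_trans (size [:: i; i0])) //.
  apply: uniq_leq_size => [|j]; first by rewrite /= inE nei.
  by rewrite !inE mem_filter mem_enum /= andbT => /orP[] /eqP ->.
have nonpos (u v : 'rV[R]_n) :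
    (forall i, 0 < d i -> ((toC u + 'i%C *: toC v) *m P^t*) 0 i = 0) ->
    bform A u u + bform A v v <= 0.
  move=> Z0; rewrite -(@lecR R) qE; apply: sumr_le0 => i _.
  have [di|di] := ltP 0 (d i); first by rewrite Z0 // normr0 expr0n mulr0.
  by rewrite mulr_le0_ge0 ?exprn_ge0 // lecR.
have q00 : bform A 0 0 = 0 by rewrite /bform !mul0mx mxE.
pose X := toC x *m P^t*; pose Y := toC y *m P^t*.
have [i0 di0 Xi0] : exists2 i, 0 < d i & X 0 i != 0.
  have [/existsP[i /andP[]]|/existsPn h] :=
    boolP [exists i, (0 < d i) && (X 0 i != 0)]; first by exists i.
  move: qx0; rewrite ltNge => /negP; case.
  have := nonpos x 0; rewrite q00 addr0; apply => i di.
  rewrite map_mx0 scaler0 addr0; have := h i.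
  by rewrite di negbK => /eqP.
pose mu := Y 0 i0 / X 0 i0; pose a := complex.Re mu; pose b := complex.Im mu.
have muE : mu = a%:C + 'i%C * b%:C by rewrite [LHS]complexE.
have : bform A (y - a *: x) (y - a *: x) + bform A (- b *: x) (- b *: x) <= 0.
  apply: nonpos => i di; have -> : i = i0.
    by apply/eqP; apply: contraLR di => /(dneg _ _ di0); rewrite -leNgt.
  have -> : toC (y - a *: x) + 'i%C *: toC (- b *: x) = toC y - mu *: toC x.
    rewrite muE; apply/matrixP => j k; rewrite !mxE.
    by rewrite !(rmorphB, rmorphM, rmorphN) /=; ring.
  have entryB (M N : 'rV[R[i]]_n) : (M - mu *: N) 0 i0 = M 0 i0 - mu * N 0 i0.
    by rewrite !mxE.
  by rewrite mulmxBl -scalemxAl entryB divfK // subrr.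
rewrite -scaleNr !(bformDl, bformDr, bformZl, bformZr) (bformC y x sA).
set q := bform A x x in qx0 *; set r := bform A x y; set t := bform A y y.
(* Times [q], the inequality reads [q * t + (r - a * q) ^+ 2 + (b * q) ^+ 2 <= r ^+ 2]. *)
move=> /(mulr_ge0_le0 (ltW qx0)) h.
have := addr_ge0 (sqr_ge0 (r - a * q)) (sqr_ge0 (b * q)); lra.
Qed.

(** Eigenvectors of two positive eigenvalues span a complex plane, which contains a nonzero
    [z = u + i v] with [z *m w = 0]. As [w] is real, [u] and [v] also lie in the hyperplane, yet the
    hermitian form is positive at [z]. *)
Lemma at_most_one_pos_eigenvalue_hyperplane A (w : 'cV[R]_n) : A^T = A ->
  (forall u, u *m w = 0 -> bform A u u <= 0) -> at_most_one_pos_eigenvalue A.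
Proof.
move=> sA neg; have [d [P [uP chd qE]]] := real_spectral sA.
exists (codom d); first by rewrite chd big_map big_enum.
rewrite count_map -size_filter leqNgt; apply/negP.
set s := [seq _ <- _ | _] => gt1.
have us : uniq s by rewrite filter_uniq ?enum_uniq.
have [i [j [nij di dj]]] : exists i j, [/\ i != j, 0 < d i & 0 < d j].
  have sP i : i \in s -> 0 < d i by rewrite mem_filter => /andP[].
  move: gt1 us sP; case: s => [|i [|j s]] //= _ /andP[+ _] sP.
  by rewrite inE negb_or => /andP[nij _]; exists i, j; rewrite !sP ?inE ?eqxx ?orbT.
pose l k : R[i] := (row k P *m toC w) 0 0.
have [al [be [nz lz]]] : exists al be : R[i],
    (al != 0) || (be != 0) /\ al * l i + be * l j = 0.
  have [li0|li] := eqVneq (l i) 0.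
    by exists 1, 0; rewrite oner_eq0 li0 mulr0 mul0r addr0.
  by exists (- l j), (l i); rewrite li orbT; split=> //; ring.
pose z := al *: row i P + be *: row j P.
pose u := map_mx (@complex.Re R) z; pose v := map_mx (@complex.Im R) z.
have zE : z = toC u + 'i%C *: toC v.
  by apply/matrixP => a b; rewrite !mxE [LHS]complexE.
have entryD (M N : 'M[R[i]]_1) : (al *: M + be *: N) 0 0 = al * M 0 0 + be * N 0 0.
  by rewrite !mxE.
have zw : z *m toC w = 0.
  apply/matrixP => a b; rewrite !ord1 mulmxDl -!scalemxAl entryD.
  by rewrite [RHS]mxE.
have [u0 v0] : u *m w = 0 /\ v *m w = 0.
  move: zw; rewrite zE mulmxDl -scalemxAl -!map_mxM => /matrixP h.
  have {h} /eqP : ((u *m w) 0 0)%:C + 'i%C * ((v *m w) 0 0)%:C = 0.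
    by have := h 0 0; rewrite !mxE.
  rewrite -[X in X == _]/(_%:C + 'i%C * _%:C) eq_complex /= => /andP[].
  rewrite !(mul0r, mul1r, mulr0, subr0, addr0, add0r) => /eqP e1 /eqP e2.
  by split; apply/matrixP => a b; rewrite !ord1 [RHS]mxE.
have zP : z *m P^t* = al *: delta_mx 0 i + be *: delta_mx 0 j.
  by rewrite mulmxDl -!scalemxAl -!row_mul (unitarymxP uP) !rowE !mulmx1.
have := lerD (neg _ u0) (neg _ v0); rewrite addr0 -(@lecR R) qE -zE zP.
apply/negP/negbT/lt_geF.
rewrite (bigD1 i) //= (bigD1 j) /=; last by rewrite eq_sym.
rewrite big1 ?addr0 => [|k /andP[ki kj]]; last first.
  rewrite !mxE (negbTE ki) (negbTE kj) !mulr0 addr0 normr0 expr0n.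
  exact: mulr0.
rewrite !mxE !eqxx (negbTE nij) eq_sym (negbTE nij) /= !mulr1 !mulr0 addr0 add0r.
case/orP: nz => nz.
  apply: ltr_pwDl; last by rewrite mulr_ge0 ?exprn_ge0 // lecR ltW.
  by rewrite mulr_gt0 ?exprn_gt0 ?normr_gt0 // ltcR.
apply: ltr_wpDl; first by rewrite mulr_ge0 ?exprn_ge0 // lecR ltW.
by rewrite mulr_gt0 ?exprn_gt0 ?normr_gt0 // ltcR.
Qed.

End QuadraticForms.

(** * Inequalities between the entries of a positive hyperbolic matrix *)

Section HyperbolicInequalities.
Context {R : realType} {n : nat} (A : 'M[R]_n).
Hypotheses (sA : A^T = A) (posA : forall i j, 0 < A i j)
  (hypA : at_most_one_pos_eigenvalue A).

Let symA i j : A i j = A j i.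
Proof. by rewrite -[in LHS]sA mxE. Qed.

Lemma bform_pair (i j k l : 'I_n) (a b c d : R) :
  bform A (a *: delta_mx 0 i + b *: delta_mx 0 j)
          (c *: delta_mx 0 k + d *: delta_mx 0 l) =
  a * c * A i k + a * d * A i l + b * c * A j k + b * d * A j l.
Proof. by rewrite !(bformDl, bformDr, bformZl, bformZr) !bform_delta; ring. Qed.

(** Reverse Cauchy-Schwarz for [e_i] and [A i k e_j + A i j e_k]: the weights give the mixed value
    [2 * A i j * A i k], and the terms in [A j j] and [A k k] are dropped. *)
Lemma hyperbolic_triangle i j k : A i i * A j k <= 2 * A i j * A i k.
Proof.
have [pij pik] := (posA i j, posA i k).
have pp := mulr_gt0 pij pik.
have := at_most_one_pos_eigenvalue_cs (A i k *: delta_mx 0 j + A i j *: delta_mx 0 k)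
  sA hypA (x := 1 *: delta_mx 0 i + 0 *: delta_mx 0 i).
rewrite !bform_pair (symA k j) => h.
have {h} := h _; rewrite !(mul0r, mul1r, mulr0, addr0) => /(_ (posA i i)) h.
rewrite -(ler_pM2l pp).
have := mulr_ge0 (ltW (posA i i)) (mulr_ge0 (sqr_ge0 (A i k)) (ltW (posA j j))).
have := mulr_ge0 (ltW (posA i i)) (mulr_ge0 (sqr_ge0 (A i j)) (ltW (posA k k))).
lra.
Qed.

(* The square roots obey Ptolemy's inequality
   [sqrt (A i j * A k l) <= sqrt (A i k * A j l) + sqrt (A i l * A j k)]. *)
Lemma hyperbolic_ptolemy i j k l :
  A i j * A k l <= 4 * (A i k * A j l) \/ A i j * A k l <= 4 * (A i l * A j k).
Proof.
pose p := Num.sqrt (A i k); pose q := Num.sqrt (A j l).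
pose r := Num.sqrt (A i l); pose t := Num.sqrt (A j k).
have [p0 q0 r0 t0] : [/\ 0 < p, 0 < q, 0 < r & 0 < t] by rewrite !sqrtr_gt0.
have sq i1 i2 : A i1 i2 = Num.sqrt (A i1 i2) ^+ 2 by rewrite sqr_sqrtr // ltW.
rewrite (sq i k) (sq j l) (sq i l) (sq j k) -/p -/q -/r -/t.
have pqrt : 0 < p * q * r * t by rewrite !mulr_gt0.
(* The weights [q t], [p r] on [e_i], [e_j] and [q r], [p t] on [e_k], [e_l] make the mixed value
   [2 p q r t (p q + r t)]. *)
have x2 : 2 * (p * q * r * t) * A i j <=
  bform A ((q * t) *: delta_mx 0 i + (p * r) *: delta_mx 0 j)
          ((q * t) *: delta_mx 0 i + (p * r) *: delta_mx 0 j).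
  rewrite bform_pair (symA j i).
  have := mulr_ge0 (sqr_ge0 (q * t)) (ltW (posA i i)).
  have := mulr_ge0 (sqr_ge0 (p * r)) (ltW (posA j j)).
  lra.
have y2 : 2 * (p * q * r * t) * A k l <=
  bform A ((q * r) *: delta_mx 0 k + (p * t) *: delta_mx 0 l)
          ((q * r) *: delta_mx 0 k + (p * t) *: delta_mx 0 l).
  rewrite bform_pair (symA l k).
  have := mulr_ge0 (sqr_ge0 (q * r)) (ltW (posA k k)).
  have := mulr_ge0 (sqr_ge0 (p * t)) (ltW (posA l l)).
  lra.
have pos2 i1 i2 : 0 < 2 * (p * q * r * t) * A i1 i2 by rewrite !mulr_gt0.
have := at_most_one_pos_eigenvalue_cs
  ((q * r) *: delta_mx 0 k + (p * t) *: delta_mx 0 l) sA hypA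
  (lt_le_trans (pos2 _ _) x2).
rewrite [X in _ <= X ^+ 2]bform_pair (sq i k) (sq j l) (sq i l) (sq j k).
rewrite -/p -/q -/r -/t.
move/(le_trans (ler_pM (ltW (pos2 _ _)) (ltW (pos2 _ _)) x2 y2)) => h.
have {h} h : A i j * A k l <= (p * q + r * t) ^+ 2.
  have x0 : 0 < 4 * (p * q * r * t) ^+ 2 by rewrite mulr_gt0 ?exprn_gt0.
  by rewrite -(ler_pM2l x0); apply: le_trans (le_trans _ h) _;
    rewrite le_eqVlt; apply/orP; left; apply/eqP; ring.
have [pq0 rt0] : 0 <= p * q /\ 0 <= r * t by split; apply/ltW/mulr_gt0.
(* The sum is at most twice its larger term; squaring gives the constant 4. *)
have [le|/ltW le] := leP (r * t) (p * q); [left|right];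
  apply: le_trans h _; rewrite -exprMn.
  by have := ler_pM rt0 rt0 le le; have := ler_wpM2l pq0 le; lra.
by have := ler_pM pq0 pq0 le le; have := ler_wpM2l rt0 le; lra.
Qed.

End HyperbolicInequalities.

(** * The cubic bound *)

Lemma hess_sym (R : realType) n (f : {mpoly R[n]}) b : (Hess f b)^T = Hess f b.
Proof. by apply/matrixP => i j; rewrite !mxE -addmA (addmC U_(j)%MM) addmA. Qed.

Lemma mem_Delta n d (a : 'X_{1..n}) : (a \in Delta n d) = (mdeg a == d).
Proof.
apply/imfsetP/idP => [[b /=]|ad]; first by move=> + ->; rewrite inE /=.
have lt : (mdeg a < d.+1)%N by rewrite (eqP ad).
by exists (BMultinom lt).
Qed.

Section SymmetricTensorBound.
Context {R : realFieldType} {T : Type} (c : T -> T -> T -> R).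
Hypotheses (c_gt0 : forall i j k, 0 < c i j k)
  (c_rot : forall i j k, c i j k = c j k i)
  (c_rev : forall i j k, c i j k = c k j i)
  (triangle : forall i j k l, c i j j * c i k l <= 2 * c i j k * c i j l)
  (ptolemy : forall i j k l m,
    c i j k * c i l m <= 4 * (c i j l * c i k m) \/
    c i j k * c i l m <= 4 * (c i j m * c i k l)).

(** In the product of the four inequalities, the entries foreign to the claim occur on both sides
    and cancel: [c p r s], [c p s t], [c p q s] in the first branch, [c p r s], [c p q r], [c r s s]
    in the second. *)
Lemma symmetric_tensor_bound (p q r s t : T) :
  c p p p * c p p q * c p r t * c r r s * c s s t <=
  32 * (c p p r * c p p s * c p p t * c q r s * c r s t).
Proof.
have mul4 (a1 b1 a2 b2 a3 b3 a4 b4 : R) : 0 < a1 -> 0 < a2 -> 0 < a3 -> 0 < a4 ->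
    a1 <= b1 -> a2 <= b2 -> a3 <= b3 -> a4 <= b4 ->
    a1 * a2 * (a3 * a4) <= b1 * b2 * (b3 * b4).
  by move=> *; rewrite !ler_pM ?mulr_ge0 // ltW.
have pos2 i1 i2 i3 j1 j2 j3 : 0 < c i1 i2 i3 * c j1 j2 j3 by rewrite mulr_gt0.
have [le1|le1] := ptolemy p p q r s.
  have le2 := triangle p p s t.
  have le3 : c r r s * c p q s <= 2 * c p r s * c q r s.
    have := triangle s r p q.
    by rewrite (c_rot s r r) (c_rot s p q) (c_rev s r p) (c_rev s r q).
  have le4 : c s s t * c p r t <= 2 * c p s t * c r s t.
    have := triangle t s p r.
    by rewrite (c_rot t s s) (c_rot t p r) (c_rev t s p) (c_rev t s r).
  have h := mul4 _ _ _ _ _ _ _ _ (pos2 _ _ _ _ _ _) (pos2 _ _ _ _ _ _)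
    (pos2 _ _ _ _ _ _) (pos2 _ _ _ _ _ _) le1 le2 le3 le4.
  rewrite -(ler_pM2l (mulr_gt0 (pos2 p r s p s t) (c_gt0 p q s))).
  move: h; clear.
  move: (c p p p) (c p p q) (c p r t) (c r r s) (c s s t) (c p p r) (c p p s).
  move: (c p p t) (c q r s) (c r s t) (c p r s) (c p s t) (c p q s)
    => t1 t2 t3 t4 t5 t6 t7 t8 t9 t10 t11 t12 t13.
  by congr (_ <= _); ring.
have le2 := triangle p p r t.
have le3 : c r s s * c p q r <= 2 * c p r s * c q r s.
  have := triangle r s p q.
  by rewrite (c_rot r p q) -(c_rot p r s) -(c_rot q r s).
have le4 : c r r s * c s s t <= 2 * c r s s * c r s t.
  have := triangle s r s t.
  by rewrite (c_rot s r r) (c_rot s r s) (c_rev s r t) (c_rot t r s).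
have h := mul4 _ _ _ _ _ _ _ _ (pos2 _ _ _ _ _ _) (pos2 _ _ _ _ _ _)
  (pos2 _ _ _ _ _ _) (pos2 _ _ _ _ _ _) le1 le2 le3 le4.
rewrite -(ler_pM2l (mulr_gt0 (pos2 p r s p q r) (c_gt0 r s s))).
move: h; clear.
move: (c p p p) (c p p q) (c p r t) (c r r s) (c s s t) (c p p r) (c p p s).
move: (c p p t) (c q r s) (c r s t) (c p r s) (c p q r) (c r s s)
  => t1 t2 t3 t4 t5 t6 t7 t8 t9 t10 t11 t12 t13.
by congr (_ <= _); ring.
Qed.

End SymmetricTensorBound.

Section CubicBound.
Context {R : realType} {n : nat} {f : {mpoly R[n]}}.
Hypothesis fL : Lplus R 3 (Delta n 3) f.

Let c i j k := ncoef f (U_(i) + U_(j) + U_(k))%MM.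

Let c_gt0 i j k : 0 < c i j k.
Proof. by case: fL => _ ->; rewrite mem_Delta !mdegD !mdeg1. Qed.

Let c_rot i j k : c i j k = c j k i.
Proof. by rewrite /c -addmA addmC. Qed.

Let c_rev i j k : c i j k = c k j i.
Proof. by rewrite /c -addmA addmC (addmC U_(j)%MM). Qed.

Let hyp i : at_most_one_pos_eigenvalue (Hess f U_(i)).
Proof. by case: fL => -[_ _ _ h] _; apply: h; rewrite mdeg1. Qed.

Let posH i j k : 0 < Hess f U_(i) j k.
Proof. by rewrite mxE; exact: c_gt0. Qed.

Let triangle i j k l : c i j j * c i k l <= 2 * c i j k * c i j l.
Proof.
have := hyperbolic_triangle (hess_sym f U_(i)%MM) (posH i) (hyp i) j k l.
by rewrite !mxE.
Qed.

Let ptolemy i j k l m : c i j k * c i l m <= 4 * (c i j l * c i k m) \/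
                        c i j k * c i l m <= 4 * (c i j m * c i k l).
Proof.
have := hyperbolic_ptolemy (hess_sym f U_(i)%MM) (posH i) (hyp i) j k l m.
by rewrite !mxE.
Qed.

Lemma cubic_bound (p q r s t : 'I_n) :
  c p p p * c p p q * c p r t * c r r s * c s s t <=
  32 * (c p p r * c p p s * c p p t * c q r s * c r s t).
Proof. exact: (symmetric_tensor_bound c_gt0 c_rot c_rev triangle ptolemy). Qed.

End CubicBound.

(** * Bounded ratios *)

(** [F] lives on all multi-indices rather than on [S], so that it can be shifted when a local vector
    is lifted. *)
Definition pairing (R : realType) n (S : {fset 'X_{1..n}}) (w : {ffun S -> R^o})
  (F : 'X_{1..n} -> R) : R := \sum_(a : S) (w a : R) * F (val a).

Section BoundedRatios.
Context {R : realType} {n : nat}.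
Implicit Types (S : {fset 'X_{1..n}}) (f : {mpoly R[n]}).

Definition logc f (a : 'X_{1..n}) : R := exp.ln (ncoef f a).

Lemma Rmon_expR d S (w : {ffun S -> R^o}) f : Lplus R d S f ->
  Rmon w f = sequences.expR (pairing w (logc f)).
Proof.
move=> [_ pos]; rewrite exp.expR_sum; apply: eq_bigr => a _.
by rewrite /exp.powR gt_eqF // pos fsvalP.
Qed.

(** In logarithms a ratio is linear in its exponents, so all later arguments become linear ones. *)
Lemma BRP d S (w : {ffun S -> R^o}) : BR R d S w <->
  exists M, forall f, Lplus R d S f -> pairing w (logc f) <= M.
Proof.
split=> [|[M Mub]].
  rewrite /BR /=.
  set s := ereal.ereal_sup _ => supw.
  exists (exp.ln (fine s)) => f fL.
  have ubf : ((Rmon w f)%:E <= s)%E by apply: ereal.ereal_sup_ubound; exists f.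
  have : Rmon w f <= fine s.
    (* [s] is finite: below [+oo] by assumption, and at least a real number. *)
    rewrite -lee_fin fineK // fin_numE gt_eqF ?lt_eqF //.
    exact: lt_le_trans (ltNyr _) ubf.
  rewrite (Rmon_expR _ fL) => le.
  rewrite -[leLHS]exp.expRK exp.ler_ln // ?posrE ?exp.expR_gt0 //.
  exact: lt_le_trans (exp.expR_gt0 _) le.
apply: le_lt_trans (ltry (sequences.expR M)).
apply: ereal.ge_ereal_sup => _ [f fL <-].
by rewrite lee_fin (Rmon_expR _ fL) exp.ler_expR Mub.
Qed.

Lemma pairing_sum S k (a : 'I_k -> R) (v : 'I_k -> {ffun S -> R^o}) F :
  pairing (\sum_i a i *: v i) F = \sum_i a i * pairing (v i) F.
Proof.
rewrite /pairing (eq_bigr (fun b => \sum_i a i * (v i b * F (val b)))).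
  by rewrite exchange_big; apply: eq_bigr => i _; rewrite mulr_sumr.
move=> b _; rewrite sum_ffunE mulr_suml; apply: eq_bigr => i _.
by rewrite ffunE mulrA.
Qed.

Lemma Cone_BR d S : Cone (BR R d S) `<=` BR R d S.
Proof.
move=> _ [k [a [v [a0 vBR ->]]]].
have [M ubM] := boolp.choice (fun i => (BRP d (v i)).1 (vBR i)).
apply/BRP; exists (\sum_i a i * M i) => f fL; rewrite pairing_sum.
by apply: ler_sum => i _; rewrite ler_wpM2l // ubM.
Qed.

(** Lifting is adjoint to shifting by [b]: each [g] contributes at the single index [b + g], which
    lies in [S]. *)
Lemma pairing_lift S b (v : {ffun Sloc S b -> R^o}) F :
  pairing (lift_loc v) F = pairing v (fun g => F (b + g)%MM).
Proof.
rewrite /pairing (eq_bigr (fun a : S =>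
  \sum_(g : Sloc S b | val a == (b + val g)%MM) (v g : R) * F (b + val g)%MM)).
  rewrite (exchange_big_dep xpredT) //=; apply: eq_bigr => g _.
  have bgS : (b + val g)%MM \in S.
    case/imfsetP: (fsvalP g) => p /=; rewrite inE => pS ->.
    by move: pS; rewrite -addmA.
  rewrite (big_pred1 [` bgS]%fset) //.
move=> a _; rewrite ffunE mulr_suml; apply: eq_bigr => g /eqP <- //.
Qed.

End BoundedRatios.

(** * Multi-indices of given degree and full supports *)

Lemma mdeg_split n (a : 'X_{1..n}) d : mdeg a = d.+1 ->
  exists (i : 'I_n) (b : 'X_{1..n}), mdeg b = d /\ a = (b + U_(i))%MM.
Proof.
move=> ad; have [i ai] : exists i, a i != 0%N.
  apply/existsP; apply: contraPT ad => /existsPn h; rewrite mdegE big1 // => i _.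
  by apply/eqP; rewrite -[_ == _]negbK h.
have Ua : (U_(i) <= a)%MM by rewrite lep1mP.
exists i, (a - U_(i))%MM; rewrite submK //; split=> //.
by apply: succn_inj; rewrite -ad -[in RHS](submK Ua) mdegD mdeg1 addn1.
Qed.

Lemma mdeg2_split n (a : 'X_{1..n}) : mdeg a = 2%N ->
  exists i j : 'I_n, a = (U_(i) + U_(j))%MM.
Proof.
case/mdeg_split=> j [b [/eqP/mdeg1P[i /eqP ->] ->]].
by exists i, j.
Qed.

Lemma Sloc_Delta n d (b : 'X_{1..n}) : (mdeg b + 2)%N = d ->
  Sloc (Delta n d) b = Delta n 2.
Proof.
move=> bd; apply/fsetP => a; rewrite mem_Delta; apply/imfsetP/eqP => /=.
  by case=> -[i j] _ ->; rewrite mdegD !mdeg1.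
case/mdeg2_split=> i [j ->]; exists (i, j) => //=.
by rewrite inE /= mem_Delta !mdegD !mdeg1 -addnA bd.
Qed.

Lemma Mconvex_Delta n d : (0 < n)%N -> Mconvex d (Delta n d).
Proof.
move=> n0; split=> [||a b].
- apply/fset0Pn; exists (U_(Ordinal n0) *+ d)%MM.
  by rewrite mem_Delta mdegMn mdeg1 mul1n.
- exact: fsubset_refl.
rewrite !mem_Delta => /eqP ad /eqP bd i lt_ba.
(* Otherwise [b <= a] with equal degrees, so [a = b], against [b i < a i]. *)
have [j lt_ab] : exists j, (a j < b j)%N.
  apply/existsP; apply: contraTT lt_ba => /existsPn h.
  have le_ba k : (b k <= a k)%N by rewrite leqNgt h.
  rewrite -leqNgt; have := leqif_sum (fun k _ => leqif_eq (le_ba k)) (P := xpredT).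
  move=> [_]; rewrite -!mdegE ad bd eqxx => /esym/forallP/(_ i)/= /eqP ->.
  exact: leqnn.
have exch (c : 'X_{1..n}) k l : (0 < c k)%N -> mdeg c = d ->
    mdeg (c - U_(k) + U_(l))%MM == d.
  move=> ck <-; have Uc : (U_(k) <= c)%MM by rewrite lep1mP -lt0n.
  by rewrite -[in X in _ == X](submK Uc) !mdegD !mdeg1.
exists j; rewrite !mem_Delta; split=> //.
  by apply: exch; rewrite // (leq_ltn_trans _ lt_ba).
by apply: exch; rewrite // (leq_ltn_trans _ lt_ab).
Qed.

(** * Lorentzian quadratics with prescribed normalized coefficients *)

Section Quadratics.
Context {R : realType} {n : nat} (c : 'X_{1..n} -> R).

Definition quadratic : {mpoly R[n]} :=
  \sum_(m : 'X_{1..n < 3})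
     ((mdeg m == 2)%:R * (c m / (\prod_(i < n) (m i)`!)%N%:R)) *: 'X_[m].

Lemma mcoeff_quadratic a : quadratic@_a =
  (mdeg a == 2)%:R * (c a / (\prod_(i < n) (a i)`!)%N%:R).
Proof.
have [lt|ge] := ltnP (mdeg a) 3; first exact: (mcoeff_mpoly
  (fun m => (mdeg m == 2)%:R * (c m / (\prod_(i < n) (m i)`!)%N%:R)) lt).
rewrite gtn_eqF ?ge // mul0r raddf_sum /= big1 // => m _.
rewrite mcoeffZ mcoeffX; case: (bmnm m =P a) => [ma|]; last by rewrite mulr0.
by move: ge; rewrite -ma leqNgt bmdeg.
Qed.

Lemma ncoef_quadratic a : ncoef quadratic a = (mdeg a == 2)%:R * c a.
Proof.
rewrite /ncoef mcoeff_quadratic -[LHS]mulr_natr -!mulrA mulVf ?mulr1 //.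
by rewrite pnatr_eq0 -lt0n prodn_gt0 // => i; exact: fact_gt0.
Qed.

(** In degree 2 the only Hessian is the one at [b = 0], and the full support is M-convex. *)
Lemma quadratic_Lplus : (0 < n)%N -> (forall a, mdeg a = 2%N -> 0 < c a) ->
  at_most_one_pos_eigenvalue (\matrix_(i, j) c (U_(i) + U_(j))%MM) ->
  Lplus R 2 (Delta n 2) quadratic.
Proof.
move=> n0 c0 hyp; have pos a : (0 < ncoef quadratic a) = (a \in Delta n 2).
  rewrite ncoef_quadratic mem_Delta; case: eqP => [/c0|_]; rewrite ?mul1r //.
  by rewrite mul0r ltxx.
split=> //; split=> [|a||b b0].
- split.
    apply/eqP => q0; have := pos (U_(Ordinal n0) *+ 2)%MM.
    by rewrite mem_Delta mdegMn mdeg1 eqxx q0 /ncoef mcoeff0 mul0rn ltxx.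
  apply/dhomogP => a; rewrite mcoeff_msupp mcoeff_quadratic.
  by case: (mdeg a =P 2%N) => // _; rewrite mul0r eqxx.
- rewrite ncoef_quadratic; case: eqP => [/c0/ltW|_]; rewrite ?mul1r //.
  by rewrite mul0r.
- rewrite (_ : [fset a in _ | _]%fset = Delta n 2); first exact: Mconvex_Delta.
  apply/fsetP => a; rewrite !inE /= ; apply: andb_idr.
  by rewrite -pos => /lt0r_neq0.
rewrite (_ : Hess _ _ = \matrix_(i, j) c (U_(i) + U_(j))%MM) //.
have -> : b = 0%MM by apply/eqP; rewrite -mdeg_eq0 -(eqn_add2r 2) b0.
apply/matrixP => i j; rewrite !mxE ncoef_quadratic add0m.
by rewrite mdegD !mdeg1 mul1r.
Qed.

End Quadratics.

(** * Local generators and cut functions *)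

Section LocalGenerators.
Context {R : realType} {n : nat}.

(** This quadratic is the derivative of [f] of order [b]; it carries local bounds over to [f]. *)
Lemma quadratic_restrict_Lplus d (f : {mpoly R[n]}) b : (0 < n)%N ->
  (mdeg b + 2)%N = d -> Lplus R d (Delta n d) f ->
  Lplus R 2 (Delta n 2) (quadratic (fun a => ncoef f (b + a)%MM)).
Proof.
move=> n0 bd [[_ _ _ hyp] pos]; apply: quadratic_Lplus => // [a a2|].
  by rewrite pos mem_Delta mdegD a2 bd.
rewrite (_ : \matrix_(i, j) _ = Hess f b); first exact: hyp.
by apply/matrixP => i j; rewrite !mxE addmA.
Qed.

Lemma Gloc_BR d : (0 < n)%N -> Gloc R d (Delta n d) `<=` BR R d (Delta n d).
Proof.
move=> n0 _ [b [v [bd _ vBR ->]]]; have Sb := Sloc_Delta bd.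
have [M ubM] := (BRP 2 v).1 vBR.
apply/BRP; exists M => f fL; rewrite pairing_lift.
have := ubM (quadratic (fun a => ncoef f (b + a)%MM)).
rewrite [X in Lplus _ _ X]Sb => /(_ (quadratic_restrict_Lplus n0 bd fL)).
apply: le_trans; rewrite le_eqVlt; apply/orP; left; apply/eqP.
apply: eq_bigr => g _; rewrite /logc ncoef_quadratic.
have := fsvalP g; rewrite [X in _ \in X]Sb mem_Delta => ->.
by rewrite mul1r.
Qed.

(** The parity encodes the cut: at [e_i + e_j] the degree in the variables of [p] is odd exactly
    when [p] separates [i] and [j]. *)
Definition cut_weight (x : 'I_n -> R) (K : R) (p : pred 'I_n)
    (a : 'X_{1..n}) : R :=
  \sum_i x i * (a i)%:R + K * (odd (\sum_(i | p i) a i))%:R.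

Lemma cut_weightE x K p i j : cut_weight x K p (U_(i) + U_(j))%MM =
  x i + x j + K * (p i != p j)%:R.
Proof.
congr (_ + _ * _%:R).
  rewrite (eq_bigr (fun k => x k * (i == k)%:R + x k * (j == k)%:R)).
    rewrite big_split /= (bigD1 i) //= eqxx mulr1 big1 ?addr0.
      rewrite (bigD1 j) //= eqxx mulr1 big1 ?addr0 //.
      by move=> k kj; rewrite eq_sym (negbTE kj) mulr0.
    by move=> k ki; rewrite eq_sym (negbTE ki) mulr0.
  by move=> k _; rewrite mnmDE !mnm1E natrD mulrDr.
have indic k : \sum_(l | p l) (U_(k)%MM : 'X_{1..n}) l = p k.
  have [pk|npk] := boolP (p k).
    rewrite (bigD1 k) //= mnm1E eqxx big1 // => l /andP[_ lk].
    by rewrite mnm1E eq_sym (negbTE lk).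
  apply: big1 => l pl; rewrite mnm1E; case: eqP => // kl.
  by rewrite kl pl in npk.
rewrite (eq_bigr (fun k => ((U_(i)%MM : 'X_{1..n}) k + (U_(j)%MM : 'X_{1..n}) k)%N)).
  by rewrite big_split /= !indic; case: (p i) (p j) => -[].
by move=> k _; rewrite mnmDE.
Qed.

(** The entries are [w_i w_j], times [tau] across the cut. With [z] equal to [w] up to signs given
    by [p], the matrix is a combination of [w *m w^T] and [z *m z^T]; the second coefficient is
    nonpositive as [tau >= 1], so the form is nonpositive where [u *m w = 0]. *)
Lemma cut_weight_quadratic_Lplus (x : 'I_n -> R) (K t : R) (p : pred 'I_n) :
  (0 < n)%N -> 0 <= K -> 0 <= t ->
  Lplus R 2 (Delta n 2)
    (quadratic (fun a => sequences.expR (t * cut_weight x K p a))).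
Proof.
move=> n0 K0 t0; apply: quadratic_Lplus => // [a _|]; first exact: exp.expR_gt0.
set tau := sequences.expR (t * K).
have tau1 : 1 <= tau.
  by apply: le_trans (exp.expR_ge1Dx _); rewrite lerDl mulr_ge0.
pose w := (\col_i sequences.expR (t * x i)) : 'cV[R]_n.
pose z := (\col_i (sequences.expR (t * x i) * (-1) ^+ p i)) : 'cV[R]_n.
set A := (X in at_most_one_pos_eigenvalue X).
have AE : A = ((1 + tau) / 2) *: (w *m w^T) + ((1 - tau) / 2) *: (z *m z^T).
  apply/matrixP => i j; rewrite !mxE !big_ord1 !mxE cut_weightE.
  rewrite !mulrDr !exp.expRD.
  by case: (p i) (p j) => -[] /=; rewrite ?mulr0 ?mulr1 ?exp.expR0 -/tau; field.
have sA : A^T = A.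
  by rewrite AE linearD !linearZ /= !trmx_mul !trmxK.
apply: (at_most_one_pos_eigenvalue_hyperplane (w := w)) => // u uw.
have -> : bform A u u = (1 - tau) / 2 * ((u *m z) 0 0) ^+ 2.
  rewrite /bform AE mulmxDr mulmxDl -!scalemxAr -!scalemxAl !mulmxA uw.
  rewrite !mul0mx scaler0 add0r mxE -(mulmxA (u *m z)) -trmx_mul; congr (_ * _).
  by rewrite [LHS]mxE big_ord1 [X in _ * X]mxE expr2.
by rewrite mulr_le0_ge0 ?sqr_ge0 //; lra.
Qed.

Lemma BR_cut_weight_le0 (S : {fset 'X_{1..n}}) (v : {ffun S -> R^o}) x K p :
  (0 < n)%N -> 0 <= K -> S = Delta n 2 -> BR R 2 S v ->
  pairing v (cut_weight x K p) <= 0.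
Proof.
move=> n0 K0 SE /BRP[M ubM]; rewrite leNgt; apply/negP => L0.
set L := pairing _ _ in L0.
(* For this [t] the pairing [t * L] is [|M| + 1], which exceeds the bound [M]. *)
pose t := (`|M| + 1) / L.
have t0 : 0 < t by rewrite divr_gt0 // ltr_wpDl.
have := ubM (quadratic (fun a => sequences.expR (t * cut_weight x K p a))).
rewrite [X in Lplus _ _ X]SE.
move=> /(_ (cut_weight_quadratic_Lplus _ _ n0 K0 (ltW t0))).
set f := quadratic _; have -> : pairing v (logc f) = t * L.
  rewrite mulr_sumr; apply: eq_bigr => g _; rewrite /logc ncoef_quadratic.
  have := fsvalP g; rewrite [X in _ \in X]SE mem_Delta => ->.
  by rewrite mul1r exp.expRK mulrCA.
rewrite divfK ?gt_eqF // => /le_trans/(_ (ler_norm M)).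
by rewrite gerDl ler10.
Qed.

End LocalGenerators.

(** * The separating function *)

(* Found by linear programming; symmetric in the last three variables. *)
Definition nu5 (a : 'I_5 -> nat) : nat :=
  let q := ((0 < a (inord 2)) + (0 < a (inord 3)) + (0 < a (inord 4)))%N in
  match a (inord 0), a (inord 1) with
  | 3, _ => 0 | 2, 1 => 6 | 2, _ => 2 | 1, 2 => 3 | 1, 1 => 5
  | 1, _ => if q == 2 then 4 else 1
  | _, 3 => 0 | _, 2 => 2 | _, 1 => 4
  | _, _ => if q == 1 then 0 else 3
  end%N.

(** The value of [nu5] at [e_i + 2 e_j]: taking [j = k] in the decomposition below kills the cut
    terms. *)
Definition diag5 (i j : 'I_5) : nat :=
  (nth 0 (nth [::] [:: [:: 0; 3; 1; 1; 1]; [:: 6; 0; 4; 4; 4]; [:: 2; 2; 0; 3; 3];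
                      [:: 2; 2; 3; 0; 3]; [:: 2; 2; 3; 3; 0]] i) j)%N.

(** Each cut is given by one of its sides. The three cuts of slice 0 cross pairwise, so their sum is
    not a tree metric; they are tested one at a time. *)
Definition cuts5 (i : 'I_5) : seq (seq nat) :=
  (nth [::] [:: [:: [:: 1; 2]; [:: 1; 3]; [:: 1; 4]]; [::]; [:: [:: 1]; [:: 0; 2]];
               [:: [:: 1]; [:: 0; 3]]; [:: [:: 1]; [:: 0; 4]]] i)%N.

(** Doubling clears the cut weight [3/2], so the identity can be checked in [nat] on all 125
    triples. *)
Lemma nu5_decomposition (i j k : 'I_5) :
  (2 * nu5 (U_(i) + U_(j) + U_(k))%MM = diag5 i j + diag5 i k +
    3 * \sum_(p <- cuts5 i) (((j : nat) \in p) != ((k : nat) \in p)))%N.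
Proof.
rewrite /nu5 !mnmDE !mnm1E -!val_eqE /= !inordK //.
rewrite /diag5 /cuts5 unlock /=.
move: (nat_of_ord i) (ltn_ord i) (nat_of_ord j) (ltn_ord j).
move: (nat_of_ord k) (ltn_ord k).
by do 3 (case=> [|[|[|[|[|?]]]]] // _).
Qed.

Lemma pairingD (R : realType) n (S : {fset 'X_{1..n}}) (w : {ffun S -> R^o}) F G :
  pairing w (fun a => F a + G a) = pairing w F + pairing w G.
Proof. by rewrite -big_split; apply: eq_bigr => a _; rewrite mulrDr. Qed.

Lemma pairing_bigsum (R : realType) n (S : {fset 'X_{1..n}}) (w : {ffun S -> R^o})
    I (r : seq I) (F : I -> 'X_{1..n} -> R) :
  pairing w (fun a => \sum_(i <- r) F i a) = \sum_(i <- r) pairing w (F i).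
Proof. by rewrite exchange_big; apply: eq_bigr => a _; rewrite mulr_sumr. Qed.

Section FiveVariables.
Context {R : realType}.

Definition nu5R (a : 'X_{1..5}) : R := (nu5 a)%:R.

Lemma Gloc_nu5_le0 (w : {ffun Delta 5 3 -> R^o}) :
  Gloc R 3 (Delta 5 3) w -> pairing w nu5R <= 0.
Proof.
move=> [b [v [bd _ vBR ->]]]; have SE := Sloc_Delta bd.
have [i bE] : exists i, b = U_(i)%MM.
  have /mdeg1P[i /eqP ->] : mdeg b == 1%N by rewrite -(eqn_add2r 2) bd.
  by exists i.
rewrite pairing_lift -(pmulr_rle0 _ (ltr0n R 2)).
(* The linear part is a cut weight with [K = 0], and each cut is one with [x = 0] and [K = 3]. *)
have -> : 2%:R * pairing v (fun g => nu5R (b + g)%MM) =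
  pairing v (fun g => cut_weight (fun j => (diag5 i j)%:R) 0 pred0 g +
    \sum_(p <- cuts5 i) cut_weight (fun=> 0) 3 (fun j => (j : nat) \in p) g).
  rewrite mulr_sumr; apply: eq_bigr => g _; rewrite mulrCA; congr (_ * _).
  have := fsvalP g; rewrite [X in _ \in X]SE mem_Delta => /eqP.
  case/mdeg2_split=> j [k gE].
  rewrite /= gE bE addmA /nu5R -natrM nu5_decomposition.
  rewrite cut_weightE mul0r addr0 natrD (natrM _ 3%N) natrD natr_sum mulr_sumr.
  congr (_ + _); apply: eq_bigr => p _.
  by rewrite cut_weightE !add0r.
rewrite pairingD pairing_bigsum -[leRHS]addr0; apply: lerD.
  exact: BR_cut_weight_le0.
by apply: sumr_le0 => p _; exact: BR_cut_weight_le0.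
Qed.

Lemma num5_sub : {subset num5 <= Delta 5 3}.
Proof. by apply/allP; rewrite (eq_all (mem_Delta 3)) /= /mdeg unlock. Qed.

Lemma den5_sub : {subset den5 <= Delta 5 3}.
Proof. by apply/allP; rewrite (eq_all (mem_Delta 3)) /= /mdeg unlock. Qed.

Lemma pairing_w5 (F : 'X_{1..5} -> R) :
  pairing (w5 R) F = \sum_(a <- num5) F a - \sum_(a <- den5) F a.
Proof.
have indic (s : seq 'X_{1..5}) : uniq s -> {subset s <= Delta 5 3} ->
    \sum_(a : Delta 5 3) (val a \in s)%:R * F (val a) = \sum_(a <- s) F a.
  move=> us sub; rewrite -(big_seq_fsetE _ _ xpredT (fun a => (a \in s)%:R * F a)) /=.
  rewrite (eq_bigr (fun a => if a \in s then F a else 0)).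
    rewrite -big_mkcond -big_filter; apply/perm_big/uniq_perm => //.
      exact/filter_uniq/fset_uniq.
    by move=> a; rewrite mem_filter andb_idr // => /sub.
  by move=> a _; case: ifP => _; rewrite ?mul1r ?mul0r.
rewrite -!indic //.
  by rewrite -sumrB; apply: eq_bigr => a _; rewrite ffunE mulrBl.
- exact: den5_sub.
- exact: num5_sub.
Qed.

Lemma R5_le (f : {mpoly R[5]}) : Lplus R 3 (Delta 5 3) f -> R5 f <= 32.
Proof.
move=> fL.
(* Indices become sums of three unit vectors, the form in which [cubic_bound] is stated. *)
pose m (i j k : nat) : 'X_{1..5} := (U_(inord i) + U_(inord j) + U_(inord k))%MM.
have mE (s : 5.-tuple nat) (i j k : nat) : (i < 5)%N -> (j < 5)%N -> (k < 5)%N ->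
   all (fun l => nth 0%N s l == ((i == l) + (j == l) + (k == l))%N) (iota 0 5) ->
   [multinom of s] = m i j k.
  move=> i5 j5 k5 /allP h; apply/mnmP => l.
  by rewrite (mnm_nth 0%N) !mnmDE !mnm1E -!val_eqE /= !inordK //; apply/eqP/h;
    rewrite mem_iota add0n ltn_ord.
(* The nesting and the factors 1 are those left by unfolding the two products. *)
have quot_le (a1 a2 a3 a4 a5 b1 b2 b3 b4 b5 : R) :
    0 < b1 -> 0 < b2 -> 0 < b3 -> 0 < b4 -> 0 < b5 ->
    a1 * a2 * a3 * a4 * a5 <= 32 * (b1 * b2 * b3 * b4 * b5) ->
    a1 * (a2 * (a3 * (a4 * (a5 * 1)))) / (b1 * (b2 * (b3 * (b4 * (b5 * 1))))) <= 32.
  by move=> ? ? ? ? ? le; rewrite !mulr1 ler_pdivrMr ?mulr_gt0 //; lra.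
have c0 i j k : 0 < ncoef f (m i j k) by rewrite fL.2 mem_Delta !mdegD !mdeg1.
have e0 : [multinom of [:: 3; 0; 0; 0; 0]]%N = m 0 0 0 by exact: mE.
have e1 : [multinom of [:: 2; 1; 0; 0; 0]]%N = m 0 0 1 by exact: mE.
have e2 : [multinom of [:: 1; 0; 1; 0; 1]]%N = m 0 2 4 by exact: mE.
have e3 : [multinom of [:: 0; 0; 2; 1; 0]]%N = m 2 2 3 by exact: mE.
have e4 : [multinom of [:: 0; 0; 0; 2; 1]]%N = m 3 3 4 by exact: mE.
have e5 : [multinom of [:: 2; 0; 1; 0; 0]]%N = m 0 0 2 by exact: mE.
have e6 : [multinom of [:: 2; 0; 0; 1; 0]]%N = m 0 0 3 by exact: mE.
have e7 : [multinom of [:: 2; 0; 0; 0; 1]]%N = m 0 0 4 by exact: mE.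
have e8 : [multinom of [:: 0; 1; 1; 1; 0]]%N = m 1 2 3 by exact: mE.
have e9 : [multinom of [:: 0; 0; 1; 1; 1]]%N = m 2 3 4 by exact: mE.
rewrite /R5 /num5 /den5 !big_cons !big_nil.
rewrite e0 e1 e2 e3 e4 e5 e6 e7 e8 e9.
by apply: quot_le => //; exact: cubic_bound.
Qed.

(** The values are 0, 6, 4, 3, 3 on the numerator and 2, 2, 2, 4, 3 on the denominator, so the
    pairing is 16 - 13. *)
Lemma nu5_w5 : pairing (w5 R) nu5R = 3.
Proof.
rewrite pairing_w5 /nu5R /num5 /den5 !big_cons !big_nil /nu5.
rewrite !(mnm_nth 0%N) /= !inordK //=.
lra.
Qed.

End FiveVariables.

Lemma subset_Cone (R : realType) (V : lmodType R) (E F : set V) :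
  E `<=` F -> Cone E `<=` Cone F.
Proof.
move=> EF x [k [a [v [a0 vE ->]]]].
by exists k, a, v; split=> // i; exact: EF.
Qed.

Theorem theorem4p3 (R : realType) :
  [/\ forall f : {mpoly R[5]}, Lplus R 3 (Delta 5 3) f -> R5 f <= 32%:R,
      (BR R 3 (Delta 5 3) `\` Cone (Gloc R 3 (Delta 5 3))) (w5 R) &
      Cone (Gloc R 3 (Delta 5 3)) `<` BR R 3 (Delta 5 3)].
Proof.
have w5BR : BR R 3 (Delta 5 3) (w5 R).
  apply/BRP; exists (exp.ln 32) => f fL.
  have c0 a : a \in Delta 5 3 -> ncoef f a \is Num.pos by rewrite posrE fL.2.
  rewrite -exp.ler_expR [leRHS]exp.lnK ?posrE //.
  rewrite pairing_w5 exp.expRD exp.expRN !exp.expR_sum.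
  have prodE (s : seq 'X_{1..5}) : {subset s <= Delta 5 3} ->
      \prod_(a <- s) sequences.expR (logc f a) = \prod_(a <- s) ncoef f a.
    by move=> sub; apply: eq_big_seq => a /sub/c0; exact: exp.lnK.
  by rewrite !prodE; [exact: R5_le|exact: den5_sub|exact: num5_sub].
have w5Cone : ~ Cone (Gloc R 3 (Delta 5 3)) (w5 R).
  move=> [k [a [v [a0 vG w5E]]]]; have := nu5_w5 (R := R).
  rewrite w5E pairing_sum => s3.
  suff : (3 : R) <= 0 by lra.
  rewrite -s3; apply: sumr_le0 => i _.
  by rewrite mulr_ge0_le0 // Gloc_nu5_le0.
split=> //; first by move=> f; exact: R5_le.
split; last by move=> /(_ _ w5BR).
(* Local generators are bounded ratios, and bounded ratios form a cone. *)
by move=> w /(subset_Cone (@Gloc_BR R 5 3 isT)); exact: Cone_BR.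
Qed.
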